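(* Let $G, H$ be sofic groups and let $\alpha: H \curvearrowright X$ be a sofic action. Then the generalized wreath product $G \wr_{\alpha} H$ is sofic.
   Context: For a nonempty finite set $A$, $\mathrm{Sym}(A)$ is the group of permutations of $A$, with the normalized Hamming distance $d(\sigma,\tau) = |\{a \in A : \sigma(a) \neq \tau(a)\}|/|A|$. Let $\Gamma$ be a countable discrete group, $A$ a finite set, and $\varphi: \Gamma \to \mathrm{Sym}(A)$ a map (not necessarily a homomorphism). $\varphi$ is unital if $\varphi(1_\Gamma) = 1$. For finite $F \subseteq \Gamma$ and $\epsilon > 0$, $\varphi$ is $(F,\epsilon)$-multiplicative if $d(\varphi(gh), \varphi(g)\varphi(h)) < \epsilon$ for all $g,h \in F$. A countable discrete group $\Gamma$ is sofic if for all finite $F \subseteq \Gamma$ and $\epsilon > 0$ there exist a finite set $A$ and a map $\varphi: \Gamma \to \mathrm{Sym}(A)$ which is unital, $(F,\epsilon)$-multiplicative, and satisfies $d(1,\varphi(g)) > 1-\epsilon$ for all $g \in F \setminus \{1_\Gamma\}$. Let $\alpha: \Gamma \curvearrowright X$ be an action of a countable discrete group on a countable discrete set. For finite $F \subseteq \Gamma$, finite $E \subseteq X$ and $\epsilon > 0$, a map $\varphi: \Gamma \to \mathrm{Sym}(A)$ is an $(F,E,\epsilon)$-orbit approximation of $\alpha$ if there exist a finite set $B$ and a subset $S \subseteq A$ with $|S| > (1-\epsilon)|A|$ and, for each $s \in S$, an injective map $\pi_s: E \hookrightarrow B$, such that $\pi_{\varphi(g)s}(x) = \pi_s(\alpha(g^{-1})x)$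 for all $s \in S$, $g \in F$, $x \in E$ whenever $\varphi(g)s \in S$ and $\alpha(g^{-1})x \in E$. The action $\alpha$ is sofic if for all finite $F \subseteq \Gamma$, finite $E \subseteq X$ and $\epsilon > 0$ there exist a finite set $A$ and a map $\varphi: \Gamma \to \mathrm{Sym}(A)$ which is unital, $(F,\epsilon)$-multiplicative, and an $(F,E,\epsilon)$-orbit approximation of $\alpha$. For groups $G,H$ and an action $\alpha: H \curvearrowright X$ on a set, the generalized wreath product $G \wr_\alpha H$ is the semidirect product $G^{\oplus X} \rtimes_\beta H$, where $G^{\oplus X}$ is the group of finitely supported functions $X \to G$ and $\beta(h)((g_x)_{x \in X}) = (g_{\alpha(h)^{-1}x})_{x \in X}$. *)

(* Defs.v *)
From HB Require Import structures.
From mathcomp Require Import all_boot all_order.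
From mathcomp Require Import ssralg ssrnum perm finmap reals.

Set Implicit Arguments.
Unset Strict Implicit.
Unset Printing Implicit Defensive.

Import Order.TTheory GRing.Theory Num.Theory.
Local Open Scope fset_scope.
Local Open Scope ring_scope.

#[short(type="countGroupType")]
HB.structure Definition CountGroup := {G of Group G & Countable G}.

(* MathComp's [action] requires the acting group to be finite and acts on the
   right; this record is a left action of an arbitrary group. *)
Record left_action (H : groupType) (X : Type) := LeftAction {
  lact :> H -> X -> X;
  lact1 : forall x, lact 1%g x = x;
  lactM : forall g h x, lact (g * h)%g x = lact g (lact h x)
}.

Record aut_action (H N : groupType) := AutAction {
  aut_lact :> left_action H N;
  aut_lactM : forall h m n,
    aut_lact h (m * n)%g = (aut_lact h m * aut_lact h n)%g
}.

(* beta is a phantom parameter of the carrier: it determines the product. *)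
Record semidirect (H N : groupType) (beta : aut_action H N) :=
  Semidirect { sd_base : N; sd_top : H }.

Section SemidirectProduct.
Variables (H N : groupType) (beta : aut_action H N).
Implicit Types u v : semidirect beta.

Definition sd_pair u := (sd_base u, sd_top u).
Definition pair_sd (p : N * H) := Semidirect beta p.1 p.2.

Lemma sd_pairK : cancel sd_pair pair_sd.
Proof. by case. Qed.

HB.instance Definition _ := Choice.copy (semidirect beta) (can_type sd_pairK).

Definition sd_one := Semidirect beta 1%g 1%g.
Definition sd_mul u v :=
  Semidirect beta (sd_base u * beta (sd_top u) (sd_base v))%g
                  (sd_top u * sd_top v)%g.
Definition sd_inv u :=
  Semidirect beta (beta (sd_top u)^-1%g (sd_base u)^-1%g) (sd_top u)^-1%g.

Lemma aut_lact1 h : beta h 1%g = 1%g.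
Proof. by apply: (mulgI (beta h 1%g)); rewrite -aut_lactM !mulg1. Qed.

Lemma sd_mulA : associative sd_mul.
Proof.
by move=> [a x] [b y] [c z]; rewrite /sd_mul /= aut_lactM lactM !mulgA.
Qed.

Lemma sd_mul1g : left_id sd_one sd_mul.
Proof. by move=> [a x]; rewrite /sd_mul /= lact1 !mul1g. Qed.

Lemma sd_mulg1 : right_id sd_one sd_mul.
Proof. by move=> [a x]; rewrite /sd_mul /= aut_lact1 !mulg1. Qed.

Lemma sd_mulVg : left_inverse sd_one sd_inv sd_mul.
Proof.
by move=> [a x]; rewrite /sd_mul /= -aut_lactM !mulVg aut_lact1.
Qed.

Lemma sd_mulgV : right_inverse sd_one sd_inv sd_mul.
Proof.
by move=> [a x]; rewrite /sd_mul /= -lactM !mulgV lact1 mulgV.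
Qed.

HB.instance Definition _ := isGroup.Build (semidirect beta)
  sd_mulA sd_mul1g sd_mulg1 sd_mulVg sd_mulgV.

End SemidirectProduct.

HB.instance Definition _ (H N : countGroupType) (beta : aut_action H N) :=
  Countable.copy (semidirect beta) (can_type (@sd_pairK H N beta)).

Section DirectSum.
Variables (X : choiceType) (G : groupType).

Definition dsum := {fsfun X -> G with 1%g}.

HB.instance Definition _ := Choice.on dsum.

Implicit Types f g : dsum.

Definition ds_one : dsum := [fsfun with 1%g].
Definition ds_mul f g : dsum :=
  [fsfun x in finsupp f `|` finsupp g => (f x * g x)%g | 1%g].
Definition ds_inv f : dsum := [fsfun x in finsupp f => (f x)^-1%g | 1%g].

Lemma ds_oneE x : ds_one x = 1%g.
Proof. by rewrite fsfunE. Qed.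

Lemma ds_mulE f g x : ds_mul f g x = (f x * g x)%g.
Proof.
rewrite fsfunE inE !mem_finsupp; case: eqP => //= ->.
by case: eqP => //= ->; rewrite mulg1.
Qed.

Lemma ds_invE f x : ds_inv f x = (f x)^-1%g.
Proof. by rewrite fsfunE mem_finsupp; case: eqP => //= ->; rewrite invg1. Qed.

Lemma ds_mulA : associative ds_mul.
Proof. by move=> f g h; apply/fsfunP => x; rewrite !ds_mulE mulgA. Qed.

Lemma ds_mul1g : left_id ds_one ds_mul.
Proof. by move=> f; apply/fsfunP => x; rewrite ds_mulE ds_oneE mul1g. Qed.

Lemma ds_mulg1 : right_id ds_one ds_mul.
Proof. by move=> f; apply/fsfunP => x; rewrite ds_mulE ds_oneE mulg1. Qed.

Lemma ds_mulVg : left_inverse ds_one ds_inv ds_mul.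
Proof.
by move=> f; apply/fsfunP => x; rewrite ds_mulE ds_invE ds_oneE mulVg.
Qed.

Lemma ds_mulgV : right_inverse ds_one ds_inv ds_mul.
Proof.
by move=> f; apply/fsfunP => x; rewrite ds_mulE ds_invE ds_oneE mulgV.
Qed.

HB.instance Definition _ := isGroup.Build dsum
  ds_mulA ds_mul1g ds_mulg1 ds_mulVg ds_mulgV.

End DirectSum.

HB.instance Definition _ (X : countType) (G : countGroupType) :=
  Countable.on (dsum X G).

Section WreathProduct.
Variables (G H : groupType) (X : choiceType) (alpha : left_action H X).

Definition shift (h : H) (f : dsum X G) : dsum X G :=
  [fsfun x in [fset alpha h y | y in finsupp f] => f (alpha h^-1%g x) | 1%g].

Lemma shiftE h f x : shift h f x = f (alpha h^-1%g x).
Proof.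
rewrite fsfunE; case: ifPn => // xNf; apply/esym/eqP.
apply: contraNT xNf; rewrite -mem_finsupp => xf.
by apply/imfsetP; exists (alpha h^-1%g x); rewrite //= -lactM mulgV lact1.
Qed.

Lemma shift1 f : shift 1%g f = f.
Proof. by apply/fsfunP => x; rewrite shiftE invg1 lact1. Qed.

Lemma shiftM g h f : shift (g * h)%g f = shift g (shift h f).
Proof. by apply/fsfunP => x; rewrite !shiftE invgM lactM. Qed.

Lemma shift_mul h (f g : dsum X G) :
  shift h (f * g)%g = (shift h f * shift h g)%g.
Proof.
by apply/fsfunP => x; rewrite shiftE !ds_mulE !shiftE.
Qed.

Definition shift_action : aut_action H (dsum X G) :=
  @AutAction H (dsum X G) (LeftAction shift1 shiftM) shift_mul.

Definition wreath := semidirect shift_action.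

End WreathProduct.

Arguments wreath G {H X} alpha.

HB.instance Definition _ (G H : countGroupType) (X : countType)
    (alpha : left_action H X) := CountGroup.on (wreath G alpha).

(* Countability of the group being tested, including that of the wreath product
   in an instance of [sofic], is carried by its countGroupType structure. *)
Section Sofic.
Variable R : realType.

Definition hamming (A : finType) (s t : {perm A}) : R :=
  #|[set a | s a != t a]|%:R / #|A|%:R.

Definition unital (Gam : groupType) (A : finType) (phi : Gam -> {perm A}) :=
  phi 1%g = 1%g.

(* The product of {perm A} composes from left to right, so the composite
   a |-> phi g (phi h a) is phi h * phi g. *)
Definition multiplicative_on (Gam : groupType) (F : {fset Gam}) (eps : R)
    (A : finType) (phi : Gam -> {perm A}) :=
  {in F &, forall g h, hamming (phi (g * h)%g) (phi h * phi g)%g < eps}.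

Definition sofic (Gam : countGroupType) : Prop :=
  forall (F : {fset Gam}) (eps : R), 0 < eps ->
  exists (A : finType) (phi : Gam -> {perm A}),
    [/\ (0 < #|A|)%N,
        unital phi,
        multiplicative_on F eps phi
      & forall g : Gam, g \in F -> g != 1%g -> 1 - eps < hamming 1%g (phi g)].

(* The maps pi s are only constrained for s in S and on points of E; they are
   total functions on A and X for convenience, which costs nothing since B may
   always be enlarged by a point serving as a default value. *)
Definition orbit_approximation (Gam : groupType) (X : choiceType)
    (alpha : left_action Gam X) (F : {fset Gam}) (E : {fset X}) (eps : R)
    (A : finType) (phi : Gam -> {perm A}) : Prop :=
  exists (B : finType) (S : {set A}) (pi : A -> X -> B),
    [/\ (1 - eps) * #|A|%:R < #|S|%:R,
        {in S, forall s, {in E &, injective (pi s)}}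
      & forall s g x, s \in S -> g \in F -> x \in E ->
          phi g s \in S -> alpha g^-1%g x \in E ->
          pi (phi g s) x = pi s (alpha g^-1%g x)].

Definition sofic_action (Gam : countGroupType) (X : countType)
    (alpha : left_action Gam X) : Prop :=
  forall (F : {fset Gam}) (E : {fset X}) (eps : R), 0 < eps ->
  exists (A : finType) (phi : Gam -> {perm A}),
    [/\ (0 < #|A|)%N,
        unital phi,
        multiplicative_on F eps phi
      & orbit_approximation alpha F E eps phi].

End Sofic.

(* Main.v *)
(** Let theta, psi be approximations of G and H by permutations of [C] and [D],
    and let phi be an orbit approximation of alpha on [A], with labellings
    pi_s : E -> B for s in S.  The approximation of the wreath product permutes
    C^B * A * D: the element (f, h) first moves (a, d) to (phi(h) a, psi(h) d),
    and then, writing s = phi(h) a, acts by theta(f(x)) on the coordinate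
    pi_s(x) of C^B, for each x in E.  The equivariance of pi makes f at s act
    exactly as the shift of f by h at phi(h) s, whence multiplicativity; the
    factor D detects h, and a coordinate pi_s(x) with f(x) <> 1 detects f. *)

Require Import Defs.
From HB Require Import structures.
From mathcomp Require Import all_boot all_order.
From mathcomp Require Import ssralg ssrnum perm finmap reals.
From mathcomp Require Import ring lra.

Set Implicit Arguments.
Unset Strict Implicit.
Unset Printing Implicit Defensive.

Import Order.TTheory GRing.Theory Num.Theory.
Local Open Scope fset_scope.
Local Open Scope ring_scope.

(** * Uniform measure of subsets of a finite set *)

Section Density.
Variable R : realType.

(** The Hamming distance is the density of the set of disagreement, so distance estimates become
    union bounds over bad sets. On an empty type the quotient is 0. *)
Definition density (T : finType) (Z : {set T}) : R := #|Z|%:R / #|T|%:R.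

Lemma density_ge0 (T : finType) (Z : {set T}) : 0 <= density Z.
Proof. by rewrite divr_ge0 ?ler0n. Qed.

Lemma densityS (T : finType) (Y Z : {set T}) :
  Y \subset Z -> density Y <= density Z.
Proof. by move=> YZ; rewrite ler_wpM2r ?invr_ge0 ?ler0n// ler_nat subset_leq_card. Qed.

Lemma densityU (T : finType) (Y Z : {set T}) :
  density (Y :|: Z) <= density Y + density Z.
Proof.
by rewrite -mulrDl ler_wpM2r ?invr_ge0 ?ler0n// -natrD ler_nat cardsU leq_subr.
Qed.

Lemma densityC (T : finType) (Z : {set T}) :
  (0 < #|T|)%N -> density (~: Z) = 1 - density Z.
Proof.
move=> T0; have nz : #|T|%:R != 0 :> R by rewrite pnatr_eq0 -lt0n.
apply: (canRL (addrK _)).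
by rewrite -mulrDl -natrD addnC cardsC divff.
Qed.

Lemma density_bigcup (T I : finType) (Z : I -> {set T}) (d : R) :
  (forall i, density (Z i) <= d) -> density (\bigcup_i Z i) <= #|I|%:R * d.
Proof.
move=> Zd; apply: (@le_trans _ _ (\sum_(i : I) density (Z i))).
  elim/big_ind2: _ => [|Y y Y' y' lY lY'|//].
    by rewrite /density cards0 mul0r.
  exact: le_trans (densityU _ _) (lerD lY lY').
rewrite (le_trans (ler_sum _ (fun i _ => Zd i)))//.
by rewrite sumr_const mulr_natl.
Qed.

Lemma density_preim_perm (T : finType) (s : {perm T}) (Z : {set T}) :
  density [set a | s a \in Z] = density Z.
Proof. by rewrite /density -[in RHS](card_preimset Z (@perm_inj _ s)). Qed.

(** Fubini for counting: [#|Z|] is the sum over [v] of the fibre sizes, each at most [d * #|U|].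
    When a factor is empty the density is 0, whence [0 <= d]. *)
Lemma density_fibers (U V : finType) (Z : {set U * V}) (d : R) : 0 <= d ->
  (forall v, density [set u | (u, v) \in Z] <= d) -> density Z <= d.
Proof.
move=> d0 Zd; case: (posnP #|U|) => [U0|U0].
  by rewrite /density card_prod U0 mul0n invr0 mulr0.
case: (posnP #|V|) => [V0|V0].
  by rewrite /density card_prod V0 muln0 invr0 mulr0.
rewrite /density ler_pdivrMr ?ltr0n ?card_prod ?muln_gt0 ?U0//.
have -> : #|Z| = (\sum_(v : V) #|[set u | (u, v) \in Z]|)%N.
  rewrite -sum1_card (partition_big snd predT)//=.
  apply: eq_bigr => v _; rewrite -sum1_card.
  rewrite (reindex_onto (fun u => (u, v)) fst) /=; last first.
    by case=> u v' /= /andP[_ /eqP->].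
  by apply: eq_bigl => u; rewrite inE !eqxx !andbT.
have -> : d * (#|U| * #|V|)%:R = \sum_(v : V) d * #|U|%:R.
  by rewrite sumr_const -[RHS]mulr_natr natrM mulrA.
rewrite natr_sum; apply: ler_sum => v _.
by rewrite -ler_pdivrMr ?ltr0n//; exact: Zd.
Qed.

Lemma density_preim_snd (U V : finType) (Z : {set V}) :
  density [set p : U * V | p.2 \in Z] <= density Z.
Proof.
have -> : [set p : U * V | p.2 \in Z] = setX setT Z.
  by apply/setP => p; rewrite !inE.
case: (posnP #|U|) => [U0|U0].
  by rewrite [leLHS]/density card_prod U0 mul0n invr0 mulr0 density_ge0.
rewrite /density cardsX cardsT card_prod !natrM -mulf_div divff ?mul1r//.
by rewrite pnatr_eq0 -lt0n.
Qed.

Lemma density_preim_fst (U V : finType) (Z : {set U}) :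
  density [set p : U * V | p.1 \in Z] <= density Z.
Proof.
apply: density_fibers => [|v]; first exact: density_ge0.
by apply: densityS; apply/subsetP => u; rewrite !inE.
Qed.

(** The set is a product with factor [Z] at [b] and [C] at every other coordinate, so the powers of
    [#|C|] cancel in the quotient. *)
Lemma density_coord (B C : finType) (b : B) (Z : {set C}) :
  density [set u : {ffun B -> C} | u b \in Z] <= density Z.
Proof.
case: (posnP #|C|) => [C0|C0].
  have B0 : (0 < #|B|)%N by apply/card_gt0P; exists b.
  by rewrite [leLHS]/density card_ffun C0 exp0n// invr0 mulr0 density_ge0.
pose F b' : {set C} := if b' == b then Z else setT.
have -> : [set u : {ffun B -> C} | u b \in Z] = [set u | u \in family F].
  apply/setP => u; rewrite !inE; apply/idP/familyP => [ub b'|/(_ b)].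
    by rewrite /F; case: eqP => [->//|_]; rewrite in_setT.
  by rewrite /F eqxx.
rewrite /density cardsE card_family card_ffun !foldrE big_image/=.
rewrite (bigD1 b)//= {1}/F eqxx.
rewrite (eq_bigr (fun=> #|C|)); last first.
  by move=> b' /negPf b'b; rewrite /F b'b cardsT.
rewrite prod_nat_const cardC1 -(prednK (_ : 0 < #|B|)%N) /=; last first.
  by apply/card_gt0P; exists b.
rewrite expnS !natrM -mulf_div divff ?mulr1// natrX expf_neq0//.
by rewrite pnatr_eq0 -lt0n.
Qed.
End Density.

(** * The permutations approximating the wreath product *)

Section WreathApproximation.
Variables (G H : countGroupType) (X : countType) (alpha : left_action H X).
Variables (A B C D : finType) (E : {fset X}) (S : {set A}) (pi : A -> X -> B).
Variables (theta : G -> {perm C}) (phi : H -> {perm A}) (psi : H -> {perm D}).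
Implicit Types f : dsum X G.

(** [pick] inverts the labelling [pi s] on [E]. Coordinates that label no point of [E] are left
    alone, as are all coordinates when [s] is outside [S]. *)
Definition lamp (s : A) (f : dsum X G) (b : B) : {perm C} :=
  if [pick x : E | (s \in S) && (pi s (val x) == b)] is Some x
  then theta (f (val x)) else 1%g.

Lemma lampE s f x : {in E &, injective (pi s)} -> s \in S -> x \in E ->
  lamp s f (pi s x) = theta (f x).
Proof.
move=> pi_inj sS xE; rewrite /lamp; case: pickP => [y|/(_ [` xE])].
  by rewrite sS => /eqP /pi_inj -> //; exact: valP.
by rewrite sS eqxx.
Qed.

Lemma lamp_eq1 s f b : unital theta ->
  (forall x, s \in S -> x \in E -> pi s x = b -> f x = 1%g) -> lamp s f b = 1%g.
Proof.
move=> theta1 f1; rewrite /lamp; case: pickP => // x /andP[sS /eqP xb].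
by rewrite f1 //; exact: valP.
Qed.

(** For [y] in the support of [f], equivariance gives [pi a y = pi (phi h a) (alpha h y)], and on
    this common coordinate both sides act by [theta (f y)]. On all other coordinates both are the
    identity. *)
Lemma lamp_shift h f a : unital theta ->
    {in S, forall s, {in E &, injective (pi s)}} ->
    (forall x, x \in E -> alpha h^-1%g x \in E ->
      pi (phi h a) x = pi a (alpha h^-1%g x)) ->
    {in finsupp f, forall y, y \in E /\ alpha h y \in E} ->
    a \in S -> phi h a \in S ->
  lamp a f =1 lamp (phi h a) (shift alpha h f).
Proof.
move=> theta1 pi_inj pi_equiv fE aS haS b.
case: (boolP [exists y : finsupp f, pi a (val y) == b]) => [|/existsPn nb].
  case/existsP => -[y yf] /= /eqP <-; have [yE hyE] := fE _ yf.
  have hK : alpha h^-1%g (alpha h y) = y by rewrite -lactM mulVg lact1.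
  have yhy : pi a y = pi (phi h a) (alpha h y) by rewrite pi_equiv ?hK.
  rewrite [in RHS]yhy !lampE ?shiftE ?hK//; exact: pi_inj.
have f1 y : pi a y = b -> f y = 1%g.
  move=> yb; case: (finsuppP f y) => // yf.
  by have := nb [` yf]; rewrite yb eqxx.
rewrite !lamp_eq1// => [x _ xE xb|x _ _ /f1//].
(* If [alpha h^-1 x] is in the support of [f], it lies in [E] and its label over [a] is again [b],
   so [f1] applies to it. *)
rewrite shiftE; case: (finsuppP f) => // yf.
by apply: f1; rewrite -xb pi_equiv//; case: (fE _ yf).
Qed.

Definition wreath_fun (w : wreath G alpha) (z : {ffun B -> C} * (A * D)) :=
  let a := phi (sd_top w) z.2.1 in
  ([ffun b => lamp a (sd_base w) b (z.1 b)], (a, psi (sd_top w) z.2.2)).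

Lemma wreath_fun_inj w : injective (wreath_fun w).
Proof.
move=> [u [a d]] [u' [a' d']] [/ffunP uu' /perm_inj aa' /perm_inj <-].
(* Once the points of [A] agree, each coordinate is moved by one and the same permutation on both
   sides. *)
rewrite -{}aa' in uu' *; congr (_, _); apply/ffunP => b.
by have := uu' b; rewrite !ffunE; exact: perm_inj.
Qed.

Definition wreath_perm w := perm (@wreath_fun_inj w).

Lemma wreath_perm_unital :
  unital theta -> unital phi -> unital psi -> unital wreath_perm.
Proof.
move=> theta1 phi1 psi1; apply/permP => -[u [a d]].
rewrite permE /wreath_fun /= phi1 psi1 !perm1; congr (_, _).
apply/ffunP => b; rewrite ffunE lamp_eq1 ?perm1// => x _ _ _.
exact: ds_oneE.
Qed.

(** * Multiplicativity and freeness up to small density *)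

Variable R : realType.

(** The two permutations agree off five bad sets, four of density at most [d] and one that costs [d]
    for each point of [E]. *)
Lemma wreath_perm_multiplicative (d : R) (w w' : wreath G alpha) : 0 <= d ->
    unital theta -> {in S, forall s, {in E &, injective (pi s)}} ->
    (forall a x, a \in S -> phi (sd_top w) a \in S -> x \in E ->
      alpha (sd_top w)^-1%g x \in E ->
      pi (phi (sd_top w) a) x = pi a (alpha (sd_top w)^-1%g x)) ->
    {in finsupp (sd_base w), forall y, y \in E} ->
    {in finsupp (sd_base w'), forall y, y \in E /\ alpha (sd_top w) y \in E} ->
    density R (~: S) <= d ->
    hamming R (phi (sd_top w * sd_top w')%g)
      (phi (sd_top w') * phi (sd_top w))%g <= d ->
    hamming R (psi (sd_top w * sd_top w')%g)
      (psi (sd_top w') * psi (sd_top w))%g <= d ->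
    (forall x y, hamming R (theta (sd_base w x * sd_base w' y)%g)
      (theta (sd_base w' y) * theta (sd_base w x))%g <= d) ->
  hamming R (wreath_perm (w * w')%g) (wreath_perm w' * wreath_perm w)%g
    <= (#|` E|%:R + 4) * d.
Proof.
case: w w' => [f h] [f' h'] /= d0 theta1 pi_inj pi_equiv fE f'E.
move=> Sd phid psid thetad.
set T : finType := ({ffun B -> C} * (A * D))%type.
(* The orbit of [a] leaves [S] after the first move ([bad1]) or the second ([bad2]); [phi] ([bad3]),
   [psi] ([bad4]), or [theta] at the coordinate labelled by some point of [E] ([bad5]), fails to be
   multiplicative. *)
pose bad1 := [set z : T | z.2 \in [set p | p.1 \in
  [set a | phi h' a \in ~: S]]].
pose bad2 := [set z : T | z.2 \in [set p | p.1 \in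
  [set a | (phi h' * phi h)%g a \in ~: S]]].
pose bad3 := [set z : T | z.2 \in [set p | p.1 \in
  [set a | phi (h * h')%g a != (phi h' * phi h)%g a]]].
pose bad4 := [set z : T | z.2 \in [set p | p.2 \in
  [set e | psi (h * h')%g e != (psi h' * psi h)%g e]]].
pose Z (x : E) := let y := alpha h^-1%g (val x) in
  [set c | theta (f (val x) * f' y)%g c
    != (theta (f' y) * theta (f (val x)))%g c].
pose bad5 := \bigcup_(x : E)
  [set z : T | z.1 (pi (phi h (phi h' z.2.1)) (val x)) \in Z x].
have le1 : density R bad1 <= d.
  apply: le_trans (density_preim_snd _ _ _) _.
  apply: le_trans (density_preim_fst _ _ _) _.
  by rewrite density_preim_perm.
have le2 : density R bad2 <= d.
  apply: le_trans (density_preim_snd _ _ _) _.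
  apply: le_trans (density_preim_fst _ _ _) _.
  by rewrite density_preim_perm.
have le3 : density R bad3 <= d.
  apply: le_trans (density_preim_snd _ _ _) _.
  exact: le_trans (density_preim_fst _ _ _) _.
have le4 : density R bad4 <= d.
  apply: le_trans (density_preim_snd _ _ _) _.
  exact: le_trans (density_preim_snd _ _ _) _.
have le5 : density R bad5 <= #|` E|%:R * d.
  rewrite cardfE; apply: density_bigcup => x.
  (* For fixed [a] and [e] the label is a fixed coordinate, and only the function in [C^B]
     varies. *)
  apply: density_fibers => // -[a e].
  apply: le_trans (thetad (val x) (alpha h^-1%g (val x))).
  apply: le_trans (density_coord R (pi (phi h (phi h' a)) (val x)) (Z x)).
  by apply: densityS; apply/subsetP => u; rewrite !inE.
have sub : [set z | wreath_perm (Semidirect _ f h * Semidirect _ f' h')%g z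
    != (wreath_perm (Semidirect _ f' h') * wreath_perm (Semidirect _ f h))%g z]
    \subset bad1 :|: (bad2 :|: (bad3 :|: (bad4 :|: bad5))).
  apply/subsetP => -[u [a e]]; rewrite inE; apply: contraR.
  rewrite !in_setU !negb_or !inE /= !permM !negbK.
  case/and5P => aS haS /eqP phiM /eqP psiM /bigcupP good.
  rewrite !permE /wreath_fun /= phiM psiM; apply/eqP.
  congr (_, _); apply/ffunP => b; rewrite !ffunE.
  (* The lamp of [f'] was applied over [phi h' a]; transported to [phi h (phi h' a)], it uses the
     same labels as the lamp of [f]. *)
  rewrite (@lamp_shift h f')//; last by move=> x; exact: pi_equiv.
  set a2 := phi h (phi h' a) in haS *.
  case: (boolP [exists x : E, pi a2 (val x) == b]) => [|/existsPn nb].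
    case/existsP => x /eqP <-; have xE : val x \in E := valP x.
    rewrite !lampE ?ds_mulE ?shiftE//; try exact: pi_inj.
    apply/eqP; rewrite -permM; apply: contraPT good => bad; apply.
    by exists x; rewrite // !inE.
  (* On a coordinate labelling no point of [E], all three lamps are the identity. *)
  rewrite !lamp_eq1 ?perm1// => x _ xE xb;
    by have := nb [` xE]; rewrite xb eqxx.
apply: le_trans (densityS R sub) _.
have -> : (#|` E|%:R + 4) * d = d + (d + (d + (d + #|` E|%:R * d))) by ring.
by do 4!(apply: le_trans (densityU R _ _) (lerD _ _) => //).
Qed.

(** If [h] is nontrivial, a fixed point projects to a fixed point of [psi h]. Otherwise [f x] is
    nontrivial for some [x], and a fixed point either lies over the complement of [S] or has its
    coordinate labelled [x] fixed by [theta (f x)]; each case has density at most [d], the first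
    strictly less. *)
Lemma wreath_perm_free (d : R) (w : wreath G alpha) :
    (0 < #|A|)%N -> (0 < #|C|)%N -> (0 < #|D|)%N ->
    unital theta -> unital phi -> {in S, forall s, {in E &, injective (pi s)}} ->
    {in finsupp (sd_base w), forall y, y \in E} ->
    density R (~: S) < d ->
    (sd_top w != 1%g -> 1 - d < hamming R 1%g (psi (sd_top w))) ->
    (forall x, sd_base w x != 1%g ->
       1 - d < hamming R 1%g (theta (sd_base w x))) ->
  w != 1%g -> 1 - 2 * d < hamming R 1%g (wreath_perm w).
Proof.
case: w => [f h] /= A0 C0 D0 theta1 phi1 pi_inj fE Sd psi_free theta_free w1.
set T : finType := ({ffun B -> C} * (A * D))%type.
have d0 : 0 < d by apply: le_lt_trans Sd; exact: density_ge0.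
have T0 : (0 < #|T|)%N by rewrite !card_prod card_ffun !muln_gt0 expn_gt0 C0 A0.
pose fixed (Y : finType) (s : {perm Y}) := ~: [set y | (1%g : {perm Y}) y != s y].
have fixedE (Y : finType) (s : {perm Y}) : (0 < #|Y|)%N ->
    density R (fixed Y s) = 1 - hamming R 1%g s.
  by move=> Y0; rewrite densityC.
suff : density R (fixed _ (wreath_perm (Semidirect _ f h))) < 2 * d.
  by rewrite fixedE//; lra.
have in_fixed (Y : finType) (s : {perm Y}) y : (y \in fixed Y s) = (s y == y).
  by rewrite !inE negbK perm1 eq_sym.
have [h1|{}/psi_free psi_free] := eqVneq h 1%g; last first.
  apply: (@le_lt_trans _ _ (density R (fixed _ (psi h)))); last first.
    by rewrite fixedE//; lra.
  apply: le_trans (density_preim_snd R A _).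
  apply: le_trans (density_preim_snd R {ffun B -> C} _).
  apply: densityS; apply/subsetP => -[u [a e]].
  rewrite in_fixed permE => /eqP[_ _ he].
  by rewrite 2!inE in_fixed /= he.
have [x fx] : exists x, f x != 1%g.
  case: (fset_0Vmem (finsupp f)) => [f0|[x xf]]; last first.
    by exists x; rewrite -mem_finsupp.
  case/eqP: w1; rewrite h1; congr Semidirect; apply/fsfunP => x.
  by rewrite ds_oneE; case: finsuppP => //; rewrite f0.
have xE : x \in E by apply: fE; rewrite mem_finsupp.
pose bad1 := [set z : T | z.2 \in [set p | p.1 \in ~: S]].
pose bad2 := [set z : T | z.1 (pi z.2.1 x) \in fixed _ (theta (f x))].
have le1 : density R bad1 < d.
  apply: le_lt_trans (density_preim_snd _ _ _) _.
  exact: le_lt_trans (density_preim_fst _ _ _) _.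
have le2 : density R bad2 <= d.
  apply: density_fibers => [|[a e]]; first exact: ltW.
  apply: (@le_trans _ _ (density R (fixed _ (theta (f x))))); last first.
    by rewrite fixedE//; have := theta_free _ fx; lra.
  apply: le_trans (density_coord R (pi a x) _).
  by apply: densityS; apply/subsetP => u; rewrite !inE.
apply: (@le_lt_trans _ _ (density R (bad1 :|: bad2))).
  apply: densityS; apply/subsetP => -[u [a e]].
  rewrite in_fixed permE /wreath_fun /= h1 phi1 perm1 => /eqP[/ffunP uE _].
  rewrite in_setU; case: (boolP (a \in S)) => aS; apply/orP.
    right; rewrite inE in_fixed /=; have := uE (pi a x).
    by rewrite ffunE lampE// => [->//|]; exact: pi_inj.
  by left; rewrite !inE.
by have := densityU R bad1 bad2; lra.
Qed.

End WreathApproximation.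

(** * Choice of parameters and conclusion *)

Theorem theorem1 (R : realType) (G H : countGroupType) (X : countType)
    (alpha : left_action H X) :
  sofic R G -> sofic R H -> sofic_action R alpha ->
  sofic R (wreath G alpha).
Proof.
move=> soficG soficH soficX F eps eps0.
pose base (w : wreath G alpha) : dsum X G := sd_base w.
pose FH := [fset sd_top w | w in F].
pose E0 := \bigcup_(w <- F) finsupp (base w).
(* The translates are added so that a support point of one factor, shifted by the top component of
   another, stays in [E]. *)
pose E := E0 `|` [fset alpha h y | h in FH, y in E0].
(* With 1 adjoined, [K] contains every value of every base function from [F], also outside the
   supports. *)
pose K := 1%g |` [fset base w x | w in F, x in E].
(* The multiplicativity error is at most [(#|E| + 4) * d]; dividing by [#|E| + 5] makes it strictly
   less than [eps], and also gives [2 * d <= eps] for freeness. *)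
pose d := eps / (#|` E|%:R + 5).
have E5 : 0 < #|` E|%:R + 5 :> R by rewrite ltr_wpDl.
have d0 : 0 < d by exact: divr_gt0.
have [C [theta [C0 theta1 thetaM thetaF]]] := soficG K d d0.
have [D [psi [D0 psi1 psiM psiF]]] := soficH FH d d0.
have [A [phi [A0 phi1 phiM]]] := soficX FH E d d0.
case=> [B [S [pi [S_large pi_inj pi_equiv]]]].
have baseE w x : w \in F -> x \in finsupp (base w) -> x \in E0.
  by move=> wF xw; apply/bigfcupP; exists w; rewrite ?wF.
have baseK w x : w \in F -> base w x \in K.
  move=> wF; case: finsuppP => [_|xw]; first exact: fset1U1.
  apply/fset1Ur/imfset2P; exists w; rewrite //=; exists x => //=.
  by rewrite in_fsetU (baseE _ _ wF xw).
have topFH w : w \in F -> sd_top w \in FH.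
  by move=> wF; apply/imfsetP; exists w.
have Sd : density R (~: S) < d.
  have A0' : 0 < #|A|%:R :> R by rewrite ltr0n.
  rewrite densityC// ltrBlDl -ltrBlDr ltr_pdivlMr//.
pose Phi (w : wreath G alpha) := wreath_perm E S pi theta phi psi w.
exists ({ffun B -> C} * (A * D))%type, Phi; split.
- by rewrite !card_prod card_ffun !muln_gt0 expn_gt0 C0 A0.
- exact: wreath_perm_unital.
- move=> w w' wF w'F.
  have lt_eps : (#|` E|%:R + 4) * d < eps.
    by rewrite mulrCA gtr_pMr// ltr_pdivrMr// mul1r ltrD2l ltr_nat.
  apply: le_lt_trans lt_eps.
  apply: wreath_perm_multiplicative => //; try exact: ltW.
  + by move=> a x aS haS xE hxE; apply: pi_equiv => //; exact: topFH.
  + by move=> x xw; rewrite in_fsetU (baseE _ _ wF xw).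
  + move=> x xw; have xE0 := baseE _ _ w'F xw; rewrite !in_fsetU xE0; split=> //.
    apply/orP; right; apply/imfset2P.
    by exists (sd_top w); rewrite /= ?topFH//; exists x.
  + by apply/ltW/phiM; exact: topFH.
  + by apply/ltW/psiM; exact: topFH.
  + by move=> x y; apply/ltW/thetaM; exact: baseK.
move=> w wF w1; have le_eps : 2 * d <= eps.
  have := ler0n R #|` E|; rewrite mulrCA ger_pMr// ler_pdivrMr//; lra.
apply: (@le_lt_trans _ _ (1 - 2 * d)); first by rewrite lerD2l lerN2.
apply: wreath_perm_free => //.
- by move=> x xw; rewrite in_fsetU (baseE _ _ wF xw).
- by apply: psiF; exact: topFH.
- by move=> x; apply: thetaF; exact: baseK.
Qed.
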